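(* Let $L$ be a non-trivial residuated lattice satisfying the descending chain condition on filters. Then $L$ is subdirectly irreducible if and only if $L$ has a largest non-trivial zero-dimensional linear topological residuated lattice structure, i.e., among all non-discrete topologies $\tau$ on $L$ that are linear and zero-dimensional and make $(L,\tau)$ a topological residuated lattice, there is one that is finer than all the others.
   Context: A residuated lattice is an algebra $(L,\wedge,\vee,\odot,\rightarrow,0,1)$ such that $(L,\wedge,\vee,0,1)$ is a bounded lattice, $(L,\odot,1)$ is a commutative monoid, and $x\odot y\le z$ iff $x\le y\rightarrow z$; it is non-trivial if $0\ne1$. A filter is a nonempty subset closed under $\odot$ and upward closed. The descending chain condition means every strictly descending chain of filters is finite. A topological residuated lattice is a residuated lattice with a topology making $\wedge,\vee,\odot,\rightarrow$ continuous. A topology is linear if it has a base $\beta$ such that every member of $\beta$ containing $1$ is a filter; zero-dimensional if it has a clopen base. Here ''non-trivial'' for such a topology means non-discrete, and ''largest'' means finest. $L$ is subdirectly irreducible if it is trivial or the set of filters different from $\{1\}$ has a minimum element (equivalently, there is a minimum congruence different from the identity relation). *)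

(* Defs.v *)
From HB Require Import structures.
From mathcomp Require Import all_boot all_order.
From mathcomp Require Import boolp classical_sets filter topology_structure
  product_topology.

Set Implicit Arguments.
Unset Strict Implicit.
Unset Printing Implicit Defensive.

Local Open Scope classical_set_scope.

(** Residuated lattices: the bounds 0 and 1 are [\bot] and [\top]; the case
    [\bot = \top] is allowed. *)
HB.mixin Record TBLattice_isResiduated (d : Order.disp_t) L
    & Order.TBLattice d L := {
  rmul : L -> L -> L;
  rimp : L -> L -> L;
  rmulA : associative rmul;
  rmulC : commutative rmul;
  rmul1x : left_id \top%O rmul;
  residuation : forall x y z : L, (rmul x y <= z)%O = (x <= rimp y z)%O;
}.

#[short(type="residuatedLatticeType")]
HB.structure Definition ResiduatedLattice (d : Order.disp_t) :=
  { L of Order.TBLattice d L & TBLattice_isResiduated d L }.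

Section Filters.
Context {d : Order.disp_t} (L : residuatedLatticeType d).

Definition nontrivial_rl := (\bot%O : L) <> \top%O.

Definition is_rl_filter (F : set L) :=
  [/\ F !=set0,
      forall x y, F x -> F y -> F (rmul x y) &
      forall x y, F x -> (x <= y)%O -> F y].

Definition filter_dcc :=
  ~ exists F : nat -> set L,
      (forall n, is_rl_filter (F n)) /\ (forall n, F n.+1 `<` F n).

Definition nonunit_filter (F : set L) := is_rl_filter F /\ F <> [set \top%O].

Definition subdirectly_irreducible :=
  (\bot%O : L) = \top%O \/
  exists2 M, nonunit_filter M & forall F, nonunit_filter F -> M `<=` F.

End Filters.

(** A topology on [T] is a topological structure in the sense of the library.
    Such a structure also packs equality and choice operators on [T], which
    are not related to those [T] may already have; no notion below depends on
    them. *)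
Definition topology (T : Type) := Topological.axioms_ T.

Definition space (T : Type) (t : topology T) : topologicalType :=
  Topological.Pack t.

Section Topologies.
Variable T : Type.
Implicit Types t : topology T.

Definition finer t1 t2 :=
  forall U : set T, @open (space t2) U -> @open (space t1) U.

Definition discrete t := forall U : set T, @open (space t) U.

(** Not the library's [zero_dimensional], which asks that clopen sets separate
    points, and so excludes non-Hausdorff topologies. *)
Definition has_clopen_base t :=
  exists2 B : set (set (space t)), basis B & B `<=` clopen.

Definition continuous2 t (op : T -> T -> T) :=
  continuous (fun p : (space t * space t)%type => (op p.1 p.2 : space t)).

End Topologies.

Section TopologicalResiduatedLattices.
Context {d : Order.disp_t} (L : residuatedLatticeType d).
Implicit Types t : topology L.

Definition is_topological_rl t :=
  [/\ continuous2 t Order.meet, continuous2 t Order.join,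
      continuous2 t rmul & continuous2 t rimp].

Definition is_linear t :=
  exists2 B : set (set (space t)), basis B &
    forall U : set L, B U -> U \top%O -> is_rl_filter U.

Definition nontrivial_zd_linear t :=
  [/\ ~ discrete t, is_linear t, has_clopen_base t & is_topological_rl t].

End TopologicalResiduatedLattices.

(* Main.v *)
(** Topologies of the required kind are bounded by the congruence topologies.
    For a filter F, the sets saturated under the congruence of F form such a
    topology, which is discrete only if F = {1}. Conversely, in a linear
    topological residuated lattice that is not discrete, {1} is not open, so
    every neighbourhood of 1 contains a filter different from {1}, hence the
    least such filter M if there is one; the continuous polynomial
    p(z) = (z -> x) /\ (y \/ x z) satisfies p(1) = x, and p(m) = y for some m
    in M whenever x and y are congruent modulo M, so every open set is saturated
    modulo M. In the other direction, a finest topology makes every filter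
    F <> {1} open, so that two of these never meet in {1}, and a minimal one,
    which exists by the chain condition, is then the least. *)

Require Import Defs.
From HB Require Import structures.
From mathcomp Require Import all_boot all_order.
From mathcomp Require Import boolp classical_sets filter topology_structure
  product_topology.

Set Implicit Arguments.
Unset Strict Implicit.
Unset Printing Implicit Defensive.

Import Order.TTheory.
Local Open Scope order_scope.
Local Open Scope classical_set_scope.

(** * Arithmetic of residuated lattices *)

Section ResiduatedLatticeTheory.
Context {d : Order.disp_t} {L : residuatedLatticeType d}.
Implicit Types x y z m : L.

Lemma rmulx1 x : rmul x \top = x.
Proof. by rewrite rmulC rmul1x. Qed.

Lemma rmul_rimp_le x y : rmul (rimp x y) x <= y.
Proof. by rewrite residuation. Qed.

Lemma ler_rmul2r z x y : x <= y -> rmul x z <= rmul y z.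
Proof.
by move=> xy; rewrite residuation; apply: le_trans xy _; rewrite -residuation.
Qed.

Lemma ler_rmul x1 x2 y1 y2 : x1 <= y1 -> x2 <= y2 -> rmul x1 x2 <= rmul y1 y2.
Proof.
move=> h1 h2; apply: le_trans (ler_rmul2r x2 h1) _.
by rewrite (rmulC y1) (rmulC y1) ler_rmul2r.
Qed.

Lemma rmul_lel x y : rmul x y <= x.
Proof. by rewrite -{2}(rmulx1 x) ler_rmul // lex1. Qed.

Lemma rmul_ler x y : rmul x y <= y.
Proof. by rewrite rmulC rmul_lel. Qed.

Lemma le_rmul_rimp m x y : m <= rimp x y -> rmul m x <= y.
Proof. by rewrite residuation. Qed.

Lemma rimp1x x : rimp \top x = x.
Proof.
apply: le_anti; rewrite -residuation rmulx1 lexx andbT.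
by rewrite -[X in X <= _]rmulx1 residuation.
Qed.

Lemma rimp_eq1 x y : rimp x y = \top -> x <= y.
Proof. by move=> e; rewrite -[x]rmul1x residuation e. Qed.

Lemma rimpxx x : rimp x x = \top.
Proof. by apply: le_anti; rewrite lex1 -residuation rmul1x lexx. Qed.

End ResiduatedLatticeTheory.

(** * Filters and their congruences *)

Section FilterCongruence.
Context {d : Order.disp_t} {L : residuatedLatticeType d}.
Variable F : set L.
Implicit Types (x y z : L) (U : set L).

(** For a filter [F], this is the order of the quotient L/F pulled back to a preorder on L. *)
Definition filter_le x y := F (rimp x y).

Definition saturated U :=
  forall x y, U x -> filter_le x y -> filter_le y x -> U y.

Definition congr_class x := [set y | filter_le x y /\ filter_le y x].

Lemma saturatedT : saturated setT.
Proof. by []. Qed.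

Lemma saturatedI : setI_closed saturated.
Proof.
by move=> U V sU sV x y [Ux Vx] xy yx; split; [apply: sU xy yx|apply: sV xy yx].
Qed.

Lemma saturated_bigcup (I : Type) (f : I -> set L) :
  (forall i, saturated (f i)) -> saturated (\bigcup_i f i).
Proof. by move=> sf x y [i _ fx] xy yx; exists i => //; apply: sf fx xy yx. Qed.

Lemma saturatedC U : saturated U -> saturated (~` U).
Proof. by move=> sU x y nUx xy yx Uy; apply: nUx; apply: sU Uy yx xy. Qed.

Lemma congr_class_sub U x : saturated U -> U x -> congr_class x `<=` U.
Proof. by move=> sU Ux y [xy yx]; apply: sU Ux xy yx. Qed.

Hypothesis filterF : is_rl_filter F.

Lemma filter_mul x y : F x -> F y -> F (rmul x y).
Proof. by case: filterF => _ h _; apply: h. Qed.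

Lemma filter_up x y : F x -> x <= y -> F y.
Proof. by case: filterF => _ _ h; apply: h. Qed.

Lemma filter1 : F \top.
Proof. by case: filterF => -[x Fx] _ up; apply: up Fx (lex1 x). Qed.

Lemma filter_le_refl x : filter_le x x.
Proof. by rewrite /filter_le rimpxx; exact: filter1. Qed.

Lemma filter_le_trans x y z :
  filter_le x y -> filter_le y z -> filter_le x z.
Proof.
move=> xy yz; apply: filter_up (filter_mul yz xy) _.
rewrite -residuation -rmulA; apply: le_rmul_rimp.
rewrite -residuation; apply: le_trans (rmul_rimp_le y z).
exact: ler_rmul (lexx _) (rmul_rimp_le x y).
Qed.

(** Modus ponens: the product of x -> y and x lies below y. *)
Lemma saturated_filter : saturated F.
Proof.
by move=> x y Fx xy _; apply: filter_up (filter_mul xy Fx) (rmul_rimp_le x y).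
Qed.

Lemma congr_class_saturated x : saturated (congr_class x).
Proof.
by move=> y z [xy yx] yz zy; split;
  [apply: filter_le_trans yz|apply: filter_le_trans yx].
Qed.

Lemma congr_class_refl x : congr_class x x.
Proof. by split; apply: filter_le_refl. Qed.

Lemma congr_class1 : congr_class \top = F.
Proof.
apply/seteqP; split=> [y [+ _]|]; first by rewrite /filter_le rimp1x.
move=> y Fy; split; rewrite /filter_le ?rimp1x//.
by apply: filter_up filter1 _; rewrite -residuation rmul1x lex1.
Qed.

(** As for the other operations below, the product of the two given implications lies in [F] and is
    below the required one. *)
Lemma filter_le_meet x x' y y' :
  filter_le x x' -> filter_le y y' -> filter_le (x `&` y)%O (x' `&` y')%O.
Proof.
move=> xx yy; apply: filter_up (filter_mul xx yy) _.
rewrite -residuation lexI; apply/andP; split.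
- exact: le_trans (ler_rmul (rmul_lel _ _) (leIl x y)) (rmul_rimp_le x x').
- exact: le_trans (ler_rmul (rmul_ler _ _) (leIr y x)) (rmul_rimp_le y y').
Qed.

Lemma filter_le_join x x' y y' :
  filter_le x x' -> filter_le y y' -> filter_le (x `|` y)%O (x' `|` y')%O.
Proof.
move=> xx yy; apply: filter_up (filter_mul xx yy) _.
(* Residuation carries the implications to the right, where the join left alone splits into two
   cases. *)
rewrite -residuation rmulC residuation leUx -!residuation.
apply/andP; split; rewrite rmulC.
- apply: le_trans (ler_rmul (rmul_lel _ _) (lexx x)) _.
  exact: le_trans (rmul_rimp_le x x') (leUl _ _).
- apply: le_trans (ler_rmul (rmul_ler _ _) (lexx y)) _.
  exact: le_trans (rmul_rimp_le y y') (leUr _ _).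
Qed.

Lemma filter_le_mul x x' y y' :
  filter_le x x' -> filter_le y y' -> filter_le (rmul x y) (rmul x' y').
Proof.
move=> xx yy; apply: filter_up (filter_mul xx yy) _.
rewrite -residuation -rmulA (rmulA _ x) (rmulC _ x) -(rmulA x) rmulA.
exact: ler_rmul (rmul_rimp_le x x') (rmul_rimp_le y y').
Qed.

(** Implication is antitone in its first argument, hence the reversed first hypothesis. *)
Lemma filter_le_imp x x' y y' :
  filter_le x' x -> filter_le y y' -> filter_le (rimp x y) (rimp x' y').
Proof.
move=> xx yy; apply: filter_up (filter_mul yy xx) _.
rewrite -!residuation -!rmulA (rmulC (rimp x y)) (rmulA (rimp x' x)).
apply: le_trans (rmul_rimp_le y y'); apply: ler_rmul (lexx _) _.
rewrite rmulC; apply: le_trans (rmul_rimp_le x y).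
exact: ler_rmul (lexx _) (rmul_rimp_le x' x).
Qed.

End FilterCongruence.

(** The topology attached to [F] is carried by a fresh alias of [L], which has
    no equality and choice operators of its own. *)
Definition congr_space {d : Order.disp_t} {L : residuatedLatticeType d}
  (F : set L) : Type := L.

(** * The topology of saturated sets *)

Section CongruenceTopology.
Context {d : Order.disp_t} {L : residuatedLatticeType d}.
Variable F : set L.

HB.instance Definition _ := gen_eqMixin (congr_space F).
HB.instance Definition _ := gen_choiceMixin (congr_space F).
HB.instance Definition _ := isOpenTopological.Build (congr_space F)
  (@saturatedT _ _ F) (@saturatedI _ _ F) (@saturated_bigcup _ _ F).

Definition congr_topology : topology L := Topological.class (congr_space F).

Lemma congr_openE (U : set L) : @open (space congr_topology) U = saturated F U.
Proof. by []. Qed.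

Hypothesis filterF : is_rl_filter F.

(** The class of [x] is itself open, and is the least neighbourhood of [x]. *)
Lemma congr_nbhs (x : L) (U : set L) :
  @nbhs _ (space congr_topology) x U <-> congr_class F x `<=` U.
Proof.
rewrite (@nbhsE (space congr_topology)); split=> [[V [oV Vx]] VU|xU].
  exact: subset_trans (congr_class_sub oV Vx) VU.
exists (congr_class F x) => //; split; last exact: congr_class_refl.
exact: (congr_class_saturated filterF).
Qed.

Definition congr_base : set (set (space congr_topology)) :=
  range (congr_class F).

Lemma basis_congr_base : basis congr_base.
Proof.
split=> [_ [x _ <-]|x U /congr_nbhs xU].
  exact: (congr_class_saturated filterF).
exists (congr_class F x) => //; split; first by exists x.
exact: congr_class_refl.
Qed.

Lemma congr_linear : is_linear congr_topology.
Proof.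
exists congr_base; first exact: basis_congr_base.
move=> _ [x _ <-] [x1 x1'].
suff -> : congr_class F x = F by [].
rewrite -[RHS](congr_class1 filterF); apply/seteqP.
by split; apply: congr_class_sub; do ?exact: (congr_class_saturated filterF).
Qed.

Lemma congr_clopen_base : has_clopen_base congr_topology.
Proof.
exists congr_base; first exact: basis_congr_base.
move=> _ [x _ <-]; have sx := congr_class_saturated filterF (x := x).
by split=> //; rewrite -openC; exact: saturatedC sx.
Qed.

(** With least neighbourhoods, continuity need only be tested on classes. *)
Lemma congr_continuous2 (op : L -> L -> L) :
  (forall x x' y y', congr_class F x x' -> congr_class F y y' ->
    congr_class F (op x y) (op x' y')) ->
  continuous2 congr_topology op.
Proof.
move=> opF [x y] U /congr_nbhs xyU.
exists (congr_class F x, congr_class F y) => [|[x' y'] [/= xx yy]].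
  by split; apply/congr_nbhs.
exact/xyU/opF.
Qed.

Lemma congr_topological_rl : is_topological_rl congr_topology.
Proof.
by split; apply: congr_continuous2 => x x' y y' [xx xx'] [yy yy']; split;
  do [exact: filter_le_meet|exact: filter_le_join|exact: filter_le_mul
     |exact: filter_le_imp].
Qed.

Lemma congr_not_discrete : F <> [set \top] -> ~ discrete congr_topology.
Proof.
move=> F1 /(_ [set \top]) s1; apply: F1; apply/seteqP; split.
  by rewrite -[X in X `<=` _](congr_class1 filterF); exact: congr_class_sub s1 _.
by move=> _ ->; exact: filter1.
Qed.

End CongruenceTopology.

Lemma congr_nontrivial_zd_linear (d : Order.disp_t)
    (L : residuatedLatticeType d) (F : set L) :
  nonunit_filter F -> nontrivial_zd_linear (congr_topology F).
Proof.
move=> [filterF F1]; split; [exact: congr_not_discrete|exact: congr_linear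
  |exact: congr_clopen_base|exact: congr_topological_rl].
Qed.

Lemma continuous2_comp (T : Type) (t : topology T) (op : T -> T -> T)
    (f g : space t -> space t) :
  continuous2 t op -> continuous f -> continuous g ->
  continuous (fun z => op (f z) (g z) : space t).
Proof.
move=> cop cf cg z.
exact: (@continuous2_cvg _ (space t) (space t) (space t) (nbhs z) _ f g op
  (f z) (g z) (cop (f z, g z)) (cf z) (cg z)).
Qed.

(** * Open sets in topological residuated lattices *)

Section TopologicalResiduatedLatticeTheory.
Context {d : Order.disp_t} {L : residuatedLatticeType d}.
Variable t : topology L.
Hypothesis t_rl : is_topological_rl t.

Let cst_cont (x : L) : continuous (fun _ : space t => x : space t).
Proof. by move=> z; exact: cvg_cst. Qed.

Let id_cont : continuous (id : space t -> space t).
Proof. by move=> z; exact: cvg_id. Qed.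

(** The continuous map sending z to (z -> x) /\ (x -> z) takes the value 1 only at z = x, so it
    pulls {1} back to {x}. *)
Lemma open_unit_discrete : @open (space t) [set \top] -> discrete t.
Proof.
case: t_rl => cI _ _ cR o1 U; rewrite openE => x Ux.
pose f z : L := (rimp x z `&` rimp z x)%O.
have cf : continuous (f : space t -> space t).
  by apply: continuous2_comp cI _ _; exact: continuous2_comp cR _ _.
have of1 := (@continuousP (space t) (space t) f).1 cf _ o1.
apply: filterS (open_nbhs_nbhs (conj of1 _)) => [z /= fz|/=]; last first.
  by rewrite /f rimpxx meetxx.
suff -> : z = x by [].
by apply: le_anti; rewrite !rimp_eq1 //;
  apply: le_anti; rewrite lex1 -fz ?leIl ?leIr.
Qed.

Lemma open_saturated (M U : set L) :
  (forall V : set L, @open (space t) V -> V \top -> M `<=` V) ->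
  is_rl_filter M -> @open (space t) U -> saturated M U.
Proof.
move=> minM filterM oU x y Ux xy yx.
case: t_rl => cI cJ cM cR.
pose p z : L := (rimp z x `&` (y `|` rmul x z))%O.
have cp : continuous (p : space t -> space t).
  apply: continuous2_comp cI _ _; first exact: continuous2_comp cR _ _.
  apply: continuous2_comp cJ _ _ => //; exact: continuous2_comp cM _ _.
have op := (@continuousP (space t) (space t) p).1 cp _ oU.
(* Both factors matter: x m <= y reduces the join in [p m] to y, and y m <= x gives y <= m -> x, so
   that the meet is y as well. *)
set m := rmul (rimp x y) (rimp y x).
have Mm : M m by exact: filter_mul.
have pU1 : (p @^-1` U) \top by rewrite /= /p rimp1x rmulx1 joinC joinKI.
suff <- : p m = y by exact: minM op pU1 m Mm.
rewrite /p (join_l _) ?(meet_r _) //.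
- rewrite -residuation rmulC; apply: le_trans (rmul_rimp_le y x).
  exact: ler_rmul (rmul_ler _ _) (lexx y).
- rewrite rmulC; apply: le_trans (rmul_rimp_le x y).
  exact: ler_rmul (rmul_lel _ _) (lexx x).
Qed.

Lemma linear_open_unit (M V : set L) :
  ~ discrete t -> is_linear t ->
  (forall F : set L, nonunit_filter F -> M `<=` F) ->
  @open (space t) V -> V \top -> M `<=` V.
Proof.
move=> nd [B [oB cB] linB] minM oV V1.
have [W [BW W1] WV] := cB _ _ (open_nbhs_nbhs (conj oV V1)).
apply: subset_trans WV; apply: minM; split; first exact: linB.
(* The basic filter [W] is not {1}, since {1} would then be open. *)
by move=> eW; apply/nd/open_unit_discrete; rewrite -eW; exact: oB.
Qed.

End TopologicalResiduatedLatticeTheory.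

(** * Minimal filters from the chain condition *)

Section MinimalFilters.
Context {d : Order.disp_t} {L : residuatedLatticeType d}.

Lemma rl_filterI (F G : set L) :
  is_rl_filter F -> is_rl_filter G -> is_rl_filter (F `&` G).
Proof.
move=> fF fG; split.
- by exists \top; split; exact: filter1.
- by move=> x y [Fx Gx] [Fy Gy]; split; exact: filter_mul.
- by move=> x y [Fx Gx] xy; split; [exact: filter_up Fx xy|exact: filter_up Gx xy].
Qed.

Lemma nonunit_filterT : nontrivial_rl L -> nonunit_filter [set: L].
Proof.
move=> nt; split; first by split=> //; exists \top.
by move=> eT; apply: nt; have : [set: L] \bot by []; rewrite eT.
Qed.

Lemma exists_minimal_filter : nontrivial_rl L -> filter_dcc L ->
  exists2 M : set L, nonunit_filter M &
    forall F, nonunit_filter F -> F `<=` M -> F = M.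
Proof.
move=> nt dcc; apply: contrapT => nmin; apply: dcc.
pose nuf := {F : set L | nonunit_filter F}.
(* Without a minimal member, each filter other than {1} strictly contains another; iterating from L
   itself, which differs from {1} because 0 <> 1, contradicts the chain condition. *)
have [|f [_ fS]] := @dependent_choice nuf
    (fun F G => sval G `<` sval F) _ (exist _ _ (nonunit_filterT nt)).
  move=> [M nM]; apply: cid; apply: contrapT => nex; apply: nmin.
  exists M => // F nF FM; apply: contrapT => neq; apply: nex.
  by exists (exist _ F nF); rewrite properEneq; split=> //; apply/eqP.
exists (fun n => sval (f n)); split=> // n.
by case: (f n) => F [].
Qed.

End MinimalFilters.

Theorem theorem7p22 (d : Order.disp_t) (L : residuatedLatticeType d)
    (L_nontrivial : nontrivial_rl L) (L_dcc : filter_dcc L) :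
  subdirectly_irreducible L <->
  exists t : topology L, nontrivial_zd_linear t /\
    forall t' : topology L, nontrivial_zd_linear t' -> finer t t'.
Proof.
split=> [[/L_nontrivial //|[M nM minM]]|[t [[nd _ _ t_rl] tmax]]].
  exists (congr_topology M); split; first exact: congr_nontrivial_zd_linear.
  move=> t' [nd lin _ rl'] U oU; rewrite congr_openE.
  apply: open_saturated oU => //; last by case: nM.
  by move=> V; exact: linear_open_unit.
(* [F] is open in its own congruence topology, which [t] refines. *)
have openF (F : set L) : nonunit_filter F -> @open (space t) F.
  move=> nF; apply: (tmax _ (congr_nontrivial_zd_linear nF)).
  by rewrite congr_openE; apply: saturated_filter; case: nF.
have [M nM minM] := exists_minimal_filter L_nontrivial L_dcc.
(* Minimality turns the intersection of [M] and [F] into [M] once it is known not to be {1};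
   otherwise {1} would be open, as an intersection of two open filters, and [t] discrete. *)
right; exists M => // F nF; rewrite -(minM (M `&` F)) //.
split; first by apply: rl_filterI; [case: nM|case: nF].
move=> e1; apply/nd/(open_unit_discrete t_rl).
by rewrite -e1; apply: openI; exact: openF.
Qed.
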